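(* Let $a$ and $b$ be positive integers such that $b$ divides $a$, and let $q\in\mathbb{Q}$. Then $f(q)\in\mathbb{Z}$ if and only if \[q\in\Bigl\{\frac{F_i}{F_{i+1}}\Bigr\}_{i\in\mathbb{N}}\quad\text{or}\quad q\in\Bigl\{-\frac{F_{i+1}}{bF_i}\Bigr\}_{i\in\mathbb{N}^{+}}.\]
   Context: Here $\mathbb{N}=\{0,1,2,\dots\}$ and $\mathbb{N}^{+}=\{1,2,3,\dots\}$. For positive integers $a,b$, the integer sequence $\{F_i\}_{i\in\mathbb{N}}$ is defined by $F_0=0$, $F_1=1$ and $F_{i+2}=aF_{i+1}+bF_i$ for $i\in\mathbb{N}$. Its generating function is taken to be the rational function \[f(t)=\frac{t}{1-at-bt^2},\] evaluated at rational $t$ (no convergence condition is imposed). *)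

(* Defs.v *)
From mathcomp Require Import all_boot all_order all_algebra.

Set Implicit Arguments.
Unset Strict Implicit.
Unset Printing Implicit Defensive.

Import GRing.Theory Num.Theory.
Local Open Scope ring_scope.

Fixpoint F (a b i : nat) {struct i} : int :=
  match i with
  | 0%N => 0
  | 1%N => 1
  | (j.+1 as i').+1 => a%:Z * F a b i' + b%:Z * F a b j
  end.

Lemma F0 (a b : nat) : F a b 0 = 0. Proof. by []. Qed.

Lemma F1 (a b : nat) : F a b 1 = 1. Proof. by []. Qed.

Lemma FSS (a b i : nat) :
  F a b i.+2 = a%:Z * F a b i.+1 + b%:Z * F a b i.
Proof. by []. Qed.

Definition genfun_den (a b : nat) (t : rat) : rat :=
  1 - a%:R * t - b%:R * t ^+ 2.

Definition genfun (a b : nat) (t : rat) : rat := t / genfun_den a b t.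

(* Division is total, with x / 0 = 0, so being an integer at t has to include
   that t is not a pole. *)
Definition genfun_integral (a b : nat) (t : rat) : Prop :=
  genfun_den a b t != 0 /\ genfun a b t \is a Num.int.

(* Main.v *)
Require Import Defs.
From mathcomp Require Import all_boot all_order all_algebra.
From mathcomp Require Import ring lra.

(** Write [D(q) = 1 - a q - b q^2], so that [f(q) = q / D(q)].  Two rational
    maps act on the points where [f] is an integer.

    - The duality [s(q) = - 1 / (b q)] preserves [f], because
      [1 / f(q) = 1 / q - a - b q] and [s] exchanges the terms [1 / q] and
      [- b q].
    - The continued fraction step [T(q) = 1 / (a + b q)] sends
      [F_i / F_(i+1)] to [F_(i+1) / F_(i+2)], and
      [f(T q) = - (a / b + q) / D(q)].  If [n = f(q)] is an integer, then
      [w = 1 / D(q)] is one too, since it is a root of the monic polynomial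
      [X^2 - (a n + 1) X - b n^2] ([inv_den_int]).  So
      [f(T q) = - ((a / b) w + n)] is an integer: this is where [b %| a] is
      used ([genfun_integral_step]).

    Starting from [q = 0], the map [T] yields the first family, and [s] then
    turns it into the second one.

    Conversely, [s] changes the sign of [q], so it is enough to show that a
    nonnegative [q] with [f(q)] an integer is some [F_i / F_(i+1)].  Suppose
    [q > 0].  Integrality of [n] and [w] forces [a q <= 1]
    ([integral_pos_le]), so [p = T^-1 (q) = (1 - a q) / (b q)] is again
    nonnegative.  Moreover [T^-1 = s T s], so [f(p)] is again an integer, and
    [f(p) = - (1 - a q) f(q)] is smaller than [f(q)] in absolute value.  The
    descent on [`|f(q)|] stops at [q = 0]. *)

Set Implicit Arguments.
Unset Strict Implicit.
Unset Printing Implicit Defensive.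

Import Order.TTheory GRing.Theory Num.Theory.
Local Open Scope ring_scope.

(** * Integrality of rational roots *)

Lemma quadratic_rational_root (x s t : rat) :
  s \is a Num.int -> t \is a Num.int -> x ^+ 2 = s * x + t ->
  x \is a Num.int.
Proof.
move=> /intrP[m ->] /intrP[n ->] hx.
have d0 : (denq x)%:~R != 0 :> rat by rewrite intr_eq0 denq_neq0.
have hz : numq x ^+ 2 = denq x * (m * numq x + n * denq x).
  apply: (@intr_inj rat).
  have hn : (numq x)%:~R = x * (denq x)%:~R by rewrite -{2}(divq_num_den x) divfK.
  rewrite !(rmorphXn, rmorphM, rmorphD) /= hn exprMn hx; ring.
have dvd_sq : (denq x %| numq x ^+ 2)%Z by rewrite hz dvdz_mulr.
have cop : (`|denq x| %| 1)%N.
  have /eqP <- : coprime `|denq x| `|numq x ^+ 2|.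
    by rewrite abszX coprimeXr // coprime_sym coprime_num_den.
  by rewrite dvdn_gcd dvdnn.
by rewrite Qint_def -absz_denq; move: cop; rewrite dvdn1 => /eqP->.
Qed.

(** * The two symmetries of the generating function *)

(** As [0^-1 = 0], this sends [0] to [0] instead of the point at infinity; it
    remains an involution and preserves [f] at every rational. *)
Definition dual (b : nat) (q : rat) : rat := - (b%:R * q)^-1.

Definition step (a b : nat) (q : rat) : rat := (a%:R + b%:R * q)^-1.

Section Symmetries.

Variables a b : nat.
Hypothesis ha : (0 < a)%N.
Hypothesis hb : (0 < b)%N.

Let b0 : b%:R != 0 :> rat.
Proof. by rewrite pnatr_eq0 -lt0n. Qed.

Let bgt0 : 0 < b%:R :> rat.
Proof. by rewrite ltr0n. Qed.

Let agt0 : 0 < a%:R :> rat.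
Proof. by rewrite ltr0n. Qed.

Lemma dualK : involutive (dual b).
Proof. by move=> q; rewrite /dual mulrN invrN opprK invfM invrK mulrA mulVf ?mul1r. Qed.

Lemma dual0 : dual b 0 = 0.
Proof. by rewrite /dual mulr0 invr0 oppr0. Qed.

Lemma genfun_den0 : genfun_den a b 0 = 1.
Proof. by rewrite /genfun_den; ring. Qed.

Lemma genfun_integral0 : genfun_integral a b 0.
Proof. by split; rewrite ?genfun_den0 ?oner_eq0 // /genfun mul0r rpred0. Qed.

Lemma den_dual (q : rat) :
  q != 0 -> genfun_den a b (dual b q) = - genfun_den a b q / (b%:R * q ^+ 2).
Proof. by move=> q0; rewrite /genfun_den /dual; field; rewrite q0 b0. Qed.

Lemma den_dual_neq0 (q : rat) :
  genfun_den a b q != 0 -> genfun_den a b (dual b q) != 0.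
Proof.
have [->|q0 d0] := eqVneq q 0; first by rewrite dual0.
by rewrite den_dual // mulf_neq0 ?oppr_eq0 ?invr_eq0 ?mulf_neq0 ?expf_neq0.
Qed.

Lemma genfun_dual (q : rat) :
  genfun_den a b q != 0 -> genfun a b (dual b q) = genfun a b q.
Proof.
have [->|q0 d0] := eqVneq q 0; first by rewrite dual0.
by rewrite /genfun den_dual // /dual; field; rewrite d0 q0 b0.
Qed.

Lemma genfun_integral_dual (q : rat) :
  genfun_integral a b q -> genfun_integral a b (dual b q).
Proof. by case=> d0 hn; split; [exact: den_dual_neq0 | rewrite genfun_dual]. Qed.

Lemma inv_den_int (q : rat) :
  genfun_integral a b q -> (genfun_den a b q)^-1 \is a Num.int.
Proof.
case=> d0 hn; set n := genfun a b q in hn.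
apply: (@quadratic_rational_root _ (a%:R * n + 1) (b%:R * n ^+ 2)).
- by rewrite rpredD ?rpred1 // rpredM // rpred_nat.
- by rewrite rpredM ?rpred_nat // rpredX.
have e : genfun_den a b q = 1 - a%:R * q - b%:R * q ^+ 2 by [].
rewrite /n /genfun; move: d0 e; set d := genfun_den a b q => d0 e.
apply: (mulfI (expf_neq0 2 d0)).
transitivity (1 : rat); first by field.
transitivity (a%:R * q + d + b%:R * q ^+ 2); last by field.
by rewrite e; ring.
Qed.

(** The relation [D(q) = 1 - a q - b q^2] divided by [D(q)], in a form that is
    linear in the integers [f(q)] and [1 / D(q)]. *)
Lemma mul_genfun (q : rat) : genfun_den a b q != 0 ->
  b%:R * q * genfun a b q = (genfun_den a b q)^-1 - a%:R * genfun a b q - 1.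
Proof.
have e : genfun_den a b q = 1 - a%:R * q - b%:R * q ^+ 2 by [].
rewrite /genfun; move: e; set d := genfun_den a b q => e d0.
apply: (mulfI d0).
transitivity (b%:R * q ^+ 2); first by field.
transitivity (1 - a%:R * q - d); last by field.
by rewrite e; ring.
Qed.

Lemma den_step (q : rat) : a%:R + b%:R * q != 0 ->
  genfun_den a b (step a b q)
    = - b%:R * genfun_den a b q / (a%:R + b%:R * q) ^+ 2.
Proof. by move=> s0; rewrite /genfun_den /step; field. Qed.

Lemma genfun_step (q : rat) : genfun_den a b q != 0 ->
  genfun a b (step a b q) = - (a%:R / b%:R + q) / genfun_den a b q.
Proof.
move=> d0; have [s0|s0] := eqVneq (a%:R + b%:R * q) 0.
  (* At the pole of the step both sides vanish, as [0^-1 = 0]. *)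
  have -> : step a b q = 0 by rewrite /step s0 invr0.
  have -> : a%:R / b%:R + q = (a%:R + b%:R * q) / b%:R by field.
  by rewrite s0 /genfun !(mul0r, oppr0).
by rewrite /genfun den_step // /step; field; rewrite d0 s0 b0.
Qed.

Lemma genfun_integral_step (q : rat) : (b %| a)%N ->
  genfun_integral a b q -> genfun_integral a b (step a b q).
Proof.
move=> /dvdnP[c ac] hq; have [d0 hn] := hq; have hw := inv_den_int hq.
split.
  have [s0|s0] := eqVneq (a%:R + b%:R * q) 0.
    by rewrite /step s0 invr0 genfun_den0 oner_eq0.
  rewrite den_step // mulf_neq0 ?invr_eq0 ?expf_neq0 //.
  by rewrite mulf_neq0 ?oppr_eq0.
have -> : genfun a b (step a b q)
    = - (c%:R * (genfun_den a b q)^-1 + genfun a b q).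
  by rewrite genfun_step // ac natrM mulfK // /genfun mulNr mulrDl.
by rewrite rpredN rpredD // rpredM // rpred_nat.
Qed.

(** * Descent *)

(** The inverse of the step is its conjugate by the duality. *)
Definition unstep (q : rat) : rat := dual b (step a b (dual b q)).

Lemma unstepE (q : rat) : q != 0 -> unstep q = (1 - a%:R * q) / (b%:R * q).
Proof.
move=> q0; rewrite /unstep {1}/dual /step /dual.
have -> : a%:R + b%:R * - (b%:R * q)^-1 = - ((1 - a%:R * q) / q).
  by field; rewrite q0 b0.
by rewrite invrN mulrN invrN opprK invfM invrK; field; rewrite q0 b0.
Qed.

Lemma unstepK (q : rat) : q != 0 -> step a b (unstep q) = q.
Proof.
move=> q0; rewrite unstepE // /step.
have -> : a%:R + b%:R * ((1 - a%:R * q) / (b%:R * q)) = q^-1.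
  by field; rewrite q0 b0.
exact: invrK.
Qed.

Lemma genfun_integral_unstep (q : rat) : (b %| a)%N ->
  genfun_integral a b q -> genfun_integral a b (unstep q).
Proof.
by move=> hba hq; do 2![apply: genfun_integral_dual || apply: genfun_integral_step => //];
   exact: genfun_integral_dual.
Qed.

Lemma genfun_unstep (q : rat) : (b %| a)%N -> q != 0 ->
  genfun_integral a b q ->
  genfun a b (unstep q) = - (1 - a%:R * q) * genfun a b q.
Proof.
move=> hba q0 hq; have [d0 _] := hq.
have hdq := genfun_integral_dual hq.
have [sd0 _] := genfun_integral_step hba hdq.
rewrite genfun_dual // genfun_step; last by have [] := hdq.
by rewrite den_dual // /genfun /dual; field; rewrite d0 q0 b0.
Qed.

(** With [n = f(q)] and [w = 1 / D(q)], the identity [b q n = w - a n - 1]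
    shows that if [D(q) < 0], then [w - a n < 1]; as [w - a n] is an integer,
    [(1 - a q) w <= 0] with [w < 0].  If [D(q) > 0], then [1 - a q > b q^2]. *)
Lemma integral_pos_le (q : rat) :
  genfun_integral a b q -> 0 < q -> a%:R * q <= 1.
Proof.
move=> hq q_gt0; have [d0 hn] := hq; have hw := inv_den_int hq.
have e : genfun_den a b q = 1 - a%:R * q - b%:R * q ^+ 2 by [].
have bq2 : 0 < b%:R * q ^+ 2 by rewrite mulr_gt0 ?exprn_gt0.
have [d_gt0|d_le0] := ltP 0 (genfun_den a b q); first by rewrite e in d_gt0; lra.
have w_lt0 : (genfun_den a b q)^-1 < 0.
  by rewrite invr_lt0 lt_neqAle d0.
have n_lt0 : genfun a b q < 0 by rewrite /genfun pmulr_rlt0.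
have bqn : b%:R * q * genfun a b q < 0 by rewrite pmulr_rlt0 ?mulr_gt0.
rewrite mul_genfun // in bqn.
have int_wan : (genfun_den a b q)^-1 - a%:R * genfun a b q \is a Num.int.
  by rewrite rpredB // rpredM // rpred_nat.
have : (genfun_den a b q)^-1 - a%:R * genfun a b q <= 0.
  move: int_wan bqn => /intrP[z ->]; rewrite subr_lt0 -[1]/(1%:~R) ltr_int.
  by rewrite -[0]/(0%:~R) ler_int; case: z => [[|?]|?].
have -> : (genfun_den a b q)^-1 - a%:R * genfun a b q
    = (1 - a%:R * q) * (genfun_den a b q)^-1 by rewrite /genfun; ring.
by rewrite nmulr_lle0 // subr_ge0.
Qed.

(** * The ratios of consecutive terms *)

Lemma F_gt0 (i : nat) : 0 < F a b i.+1.
Proof.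
suff [] : 0 < F a b i.+1 /\ 0 <= F a b i by [].
elim: i => [|i [h1 h0]]; first by [].
split; last exact: ltW.
by rewrite FSS ltr_wpDr ?mulr_ge0 ?mulr_gt0 // ltz_nat.
Qed.

Lemma step_ratio (i : nat) :
  step a b ((F a b i)%:~R / (F a b i.+1)%:~R)
    = (F a b i.+1)%:~R / (F a b i.+2)%:~R.
Proof.
have h1 : (F a b i.+1)%:~R != 0 :> rat.
  by rewrite intr_eq0 gt_eqF ?F_gt0.
have h2 : (F a b i.+2)%:~R != 0 :> rat.
  by rewrite intr_eq0 gt_eqF ?F_gt0.
have e : (F a b i.+2)%:~R
    = a%:R * (F a b i.+1)%:~R + b%:R * (F a b i)%:~R :> rat.
  by rewrite FSS rmorphD !rmorphM.
rewrite /step -[RHS]invf_div; congr (_^-1).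
by rewrite e; field.
Qed.

Lemma ratio_integral (i : nat) : (b %| a)%N ->
  genfun_integral a b ((F a b i)%:~R / (F a b i.+1)%:~R).
Proof.
move=> hba; elim: i => [|i IHi].
  by rewrite F0 mul0r; exact: genfun_integral0.
by rewrite -step_ratio; exact: genfun_integral_step.
Qed.

(** Induction on a bound for [`|f(q)|], which [unstep] decreases as long as
    [q > 0]. *)
Lemma integral_nonneg_ratio (q : rat) : (b %| a)%N ->
  genfun_integral a b q -> 0 <= q ->
  exists i, q = (F a b i)%:~R / (F a b i.+1)%:~R.
Proof.
move=> hba hq; have [_ /intrP[n en]] := hq.
have [m] := ubnP `|n|%N; elim: m => // m IHm in q n hq en *.
rewrite ltnS => n_le_m q_ge0.
have [->|q0] := eqVneq q 0; first by exists 0%N; rewrite F0 mul0r.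
have q_gt0 : 0 < q by rewrite lt_neqAle eq_sym q0.
have aq_le1 := integral_pos_le hq q_gt0.
have aq_gt0 : 0 < a%:R * q by rewrite mulr_gt0.
have hp := genfun_integral_unstep hba hq; have [_ /intrP[k ek]] := hp.
have p_ge0 : 0 <= unstep q.
  by rewrite unstepE // divr_ge0 ?subr_ge0 // ?mulr_ge0 // ltW.
have n0 : n != 0.
  have [d0 _] := hq.
  by rewrite -(@intr_eq0 rat) -en /genfun mulf_neq0 // invr_eq0.
have lt_kn : (`|k| < `|n|)%N.
  rewrite -ltz_nat !abszE -(@ltr_int rat) !intr_norm -ek -en.
  rewrite genfun_unstep // normrM normrN en (@ger0_norm _ (1 - _)) ?subr_ge0 //.
  by rewrite gtr_pMl ?normr_gt0 ?intr_eq0 // gtrBl.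
have [i ei] := IHm _ _ hp ek (leq_trans lt_kn n_le_m) p_ge0.
by exists i.+1; rewrite -(unstepK q0) ei step_ratio.
Qed.

Lemma dual_ratio (i : nat) :
  dual b ((F a b i)%:~R / (F a b i.+1)%:~R)
    = - ((F a b i.+1)%:~R / (b%:R * (F a b i)%:~R)).
Proof. by rewrite /dual mulrA invf_div. Qed.

End Symmetries.

Theorem theorem1p4 (a b : nat) (ha : (0 < a)%N) (hb : (0 < b)%N)
    (hba : (b %| a)%N) (q : rat) :
  genfun_integral a b q <->
  (exists i : nat, q = (F a b i)%:~R / (F a b i.+1)%:~R) \/
  (exists i : nat, (0 < i)%N /\
     q = - ((F a b i.+1)%:~R / (b%:R * (F a b i)%:~R))).
Proof.
split=> [hq|[[i ->]|[i [_ ->]]]].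
- have [q_ge0|q_lt0] := leP 0 q.
    by left; exact: integral_nonneg_ratio.
  right; have hdq := genfun_integral_dual hb hq.
  have [|i ei] := integral_nonneg_ratio ha hb hba hdq.
    by rewrite oppr_ge0 invr_le0 pmulr_rle0 ?ltr0n // ltW.
  exists i; rewrite -dual_ratio -ei dualK //; split=> //.
  (* For [i = 0] the dual of [q] would be [0], hence [q = 0]. *)
  case: i ei => // ei; move: q_lt0.
  by rewrite -(dualK hb q) ei F0 mul0r dual0.
- exact: ratio_integral.
by rewrite -dual_ratio; apply/genfun_integral_dual/ratio_integral.
Qed.
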